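(* Let $\mathbb{K}=\mathbb{R}$ or $\mathbb{C}$. Let $\mathcal{P}=[-1,1]$ if $\mathbb{K}=\mathbb{R}$, and $\mathcal{P}=[-1,1]\cup\{\ell\in\mathbb{C}\mid -1\le \mathrm{Re}(\ell)<1\}$ if $\mathbb{K}=\mathbb{C}$. Any infinite-dimensional irreducible weighted representation of $\mathrm{asl}_2(\mathbb{K})$ is isomorphic to $V(\ell)$ for a unique $\ell\in\mathcal{P}$.
   Context: The Lie antialgebra $\mathrm{asl}_2(\mathbb{K})$ is the $\mathbb{Z}_2$-graded $\mathbb{K}$-vector space with even part spanned by $\varepsilon$ and odd part spanned by $a,b$, with the bilinear product $\varepsilon\cdot\varepsilon=\varepsilon$, $\varepsilon\cdot a=a\cdot\varepsilon=\tfrac12 a$, $\varepsilon\cdot b=b\cdot\varepsilon=\tfrac12 b$, $a\cdot b=-b\cdot a=\tfrac12\varepsilon$, and $a\cdot a=b\cdot b=0$. A representation of $\mathrm{asl}_2(\mathbb{K})$ is a pair $(V,\chi)$ with $V=V_0\oplus V_1$ a $\mathbb{Z}_2$-graded $\mathbb{K}$-vector space and $\chi:\mathrm{asl}_2(\mathbb{K})\to\mathrm{End}(V)$ an even linear map such that $\chi_x\chi_y+(-1)^{p(x)p(y)}\chi_y\chi_x=\chi_{x\cdot y}$ for all homogeneous $x,y$ ($p$ is parity). Put $A=2\chi_a$, $B=2\chi_b$, $\mathcal{E}=2\chi_\varepsilon$; then $(V,\chi)$ is a representation exactly when $A,B$ are odd, $\mathcal{E}$ is even, and $AB-BA=\mathcal{E}$,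 $A\mathcal{E}+\mathcal{E}A=A$, $B\mathcal{E}+\mathcal{E}B=B$, $\mathcal{E}^2=\mathcal{E}$. Put $H=-(AB+BA)$. A subrepresentation is a $\mathbb{Z}_2$-graded subspace stable under all $\chi_x$. A (nonzero) representation is irreducible if it has no subrepresentation other than $0$ and itself. Two representations are isomorphic if there is a bijective linear map $\Phi:V\to V'$ (not required to preserve the gradings) with $\Phi\circ\chi_x=\chi'_x\circ\Phi$ for all $x$. A representation $V$ is weighted if $H$ has an eigenvector in $V$, i.e. there are $\ell\in\mathbb{K}$ and $v\neq 0$ in $V$ with $Hv=\ell v$. The representations $V(\ell)$, $\ell\in\mathbb{K}$, are defined as follows, where $[\cdot]$ is the integer part (floor), the $e_k$ are linearly independent vectors, $\mathcal{E}=AB-BA$, and $e_k$ is even (resp. odd) when $k$ is even (resp. odd). (a) If $\ell$ is not an odd integer: $V(\ell)=\bigoplus_{k\in\mathbb{Z}}\mathbb{K}e_k$, $Ae_k=e_{k+1}$, $Be_k=\big((1-\ell)/2-[k/2]\big)e_{k-1}$ for all $k\in\mathbb{Z}$. (b) If $\ell$ is a positive odd integer: $V(\ell)=\bigoplus_{k\ge 2-\ell}\mathbb{K}e_k$, $Ae_k=e_{k+1}$ for $k\ge 2-\ell$, $Be_k=\big((1-\ell)/2-[k/2]\big)e_{k-1}$ for $k>2-\ell$, $Be_{2-\ell}=0$. (c) If $\ell$ is a negative odd integer: $V(\ell)=\bigoplus_{k\le-\ell}\mathbb{K}e_k$, $Be_k=e_{k-1}$ for $k\le-\ell$, $Ae_k=\big((1-\ell)/2-[(k+1)/2]\big)e_{k+1}$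 for $k<-\ell$, $Ae_{-\ell}=0$. *)

(* Defs.v *)
From HB Require Import structures.
From mathcomp Require Import all_boot all_order all_algebra.
From mathcomp Require Import boolp classical_sets reals.
From mathcomp Require Import complex freeg.
From mathcomp Require Import zify ring.

Set Implicit Arguments.
Unset Strict Implicit.
Unset Printing Implicit Defensive.

Import Order.TTheory GRing.Theory Num.Theory.

Local Open Scope classical_set_scope.
Local Open Scope ring_scope.

(* Parities are booleans: false is even, true is odd. *)

(* The element s eps + (p a + q b) of asl2(K) is encoded as (s, (p, q)): the
   first factor is the even part, the second one the odd part. *)
Definition asl2 (K : numFieldType) : lmodType K := (K^o * (K^o * K^o))%type.

Section Asl2.
Variable K : numFieldType.
Implicit Types x y : asl2 K.

Definition eps : asl2 K := (1, (0, 0)).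
Definition gen_a : asl2 K := (0, (1, 0)).
Definition gen_b : asl2 K := (0, (0, 1)).

Definition asl2_part (p : bool) : set (asl2 K) :=
  if p then [set x | x.1 = 0] else [set x | x.2 = 0].

(* Bilinear extension of the multiplication table [asl2_table] below. *)
Definition asl2_mul x y : asl2 K :=
  (x.1 * y.1 + 2^-1 * (x.2.1 * y.2.2 - x.2.2 * y.2.1),
   2^-1 *: (x.1 *: y.2 + y.1 *: x.2)).

Lemma asl2_table :
  [/\ asl2_mul eps eps = eps,
      (asl2_mul eps gen_a = 2^-1 *: gen_a) /\
        (asl2_mul gen_a eps = 2^-1 *: gen_a),
      (asl2_mul eps gen_b = 2^-1 *: gen_b) /\
        (asl2_mul gen_b eps = 2^-1 *: gen_b),
      (asl2_mul gen_a gen_b = 2^-1 *: eps) /\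
        (asl2_mul gen_b gen_a = - (2^-1 *: eps))
    & (asl2_mul gen_a gen_a = 0) /\ (asl2_mul gen_b gen_b = 0)].
Proof.
split; [|split..]; congr (_, (_, _)); rewrite /= /GRing.scale /=; ring.
Qed.

End Asl2.

Arguments eps {K}.
Arguments gen_a {K}.
Arguments gen_b {K}.

(* A representation is bundled with the direct sum decomposition
   V = part false (+) part true of its underlying space. *)
Record asl2_rep (K : numFieldType) := Asl2Rep {
  rep_space :> lmodType K;
  part : bool -> set rep_space;
  chi : asl2 K -> rep_space -> rep_space;
  part_submod : forall p, submod_closed (mem (part p));
  part_sum : forall v, exists v0 v1,
    [/\ part false v0, part true v1 & v = v0 + v1];
  part_direct : forall v, part false v -> part true v -> v = 0;
  chi_linear_l : forall v, linear (chi^~ v);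
  chi_linear_r : forall x, linear (chi x);
  chi_even : forall p q x v,
    asl2_part p x -> part q v -> part (p (+) q) (chi x v);
  chi_rel : forall p q x y v, asl2_part p x -> asl2_part q y ->
    chi x (chi y v) + (-1) ^+ (p && q) *: chi y (chi x v) =
    chi (asl2_mul x y) v
}.

Section Properties.
Variable K : numFieldType.
Implicit Types V : asl2_rep K.

Definition opA V (v : V) : V := 2 *: chi gen_a v.
Definition opB V (v : V) : V := 2 *: chi gen_b v.
Definition opH V (v : V) : V := - (opA (opB v) + opB (opA v)).

Definition subrep V (W : set V) : Prop :=
  [/\ submod_closed (mem W),
      forall w, W w -> exists w0 w1,
        [/\ W w0 /\ part false w0, W w1 /\ part true w1 & w = w0 + w1]
    & forall x w, W w -> W (chi x w)].

Definition irreducible V : Prop :=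
  (exists v : V, v != 0) /\
  (forall W : set V, subrep W -> W = [set 0] \/ W = [set: V]).

Definition weighted V : Prop :=
  exists (l : K) (v : V), v != 0 /\ opH v = l *: v.

Definition infinite_dimensional V : Prop :=
  ~ exists (n : nat) (g : 'I_n -> V), forall v : V,
      exists c : 'I_n -> K, v = \sum_(i < n) c i *: g i.

Definition isomorphic V V' : Prop :=
  exists Phi : {linear V -> V'},
    bijective Phi /\ forall x v, Phi (chi x v) = chi x (Phi v).

End Properties.

Section FreeLift.
Variables (K : numFieldType) (I : choiceType) (M : lmodType K) (f : I -> M).

HB.instance Definition _ :=
  GRing.isZmodMorphism.Build {freeg I / K} M (fglift f) (lift_is_additive f).

Fact fglift_is_scalable : scalable (fglift f : {freeg I / K} -> M).
Proof.
move=> c D; rewrite -{1}(freeg_sumE D) scaler_sumr raddf_sum /=.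
rewrite -[in RHS](freeg_sumE D) [in RHS]raddf_sum scaler_sumr /=.
apply: eq_bigr => i _.
have -> : c *: << coeff i D *g i >> = << c * coeff i D *g i >> :> {freeg I / K}.
  by apply/eqP/freeg_eqP => j; rewrite coeffZ !coeffU mulrA.
by rewrite !liftU scalerA.
Qed.

HB.instance Definition _ :=
  GRing.isScalable.Build K {freeg I / K} M *:%R (fglift f) fglift_is_scalable.

End FreeLift.

Section Model.
Variables (K : numFieldType) (l : K).

Definition odd_integer : bool :=
  `[< exists2 m : int, odd `|m|%N & l = m%:~R >].

(* The indices k of the basis vectors e_k of V(l). The comparisons take place
   in K; for K = R[i] they are only used when l is an integer. *)
Definition index_range (k : int) : bool :=
  if ~~ odd_integer then true
  else if 0 < l then 2 - l <= k%:~R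
  else k%:~R <= - l.

(* Finitely supported families of scalars indexed by [index_range]. *)
Definition Vspace : lmodType K := {freeg {k : int | index_range k} / K}.

(* e_k, with the convention e_k = 0 when k is out of range; this yields
   B e_(2-l) = 0 and A e_(-l) = 0 for l a positive (resp. negative) odd
   integer. *)
Definition basis (k : int) : Vspace :=
  if insub k is Some i then << i >> else 0.

(* A e_k = coefA k e_(k+1) and B e_k = coefB k e_(k-1). Note that (m %/ 2)%Z
   is the floor of m / 2. *)
Definition coefA (k : int) : K :=
  if odd_integer && (l < 0) then (1 - l) / 2 - ((k + 1) %/ 2)%Z%:~R else 1.

Definition coefB (k : int) : K :=
  if odd_integer && (l < 0) then 1 else (1 - l) / 2 - (k %/ 2)%Z%:~R.

Definition VA : Vspace -> Vspace :=
  fglift (fun i => coefA (val i) *: basis (val i + 1)).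
Definition VB : Vspace -> Vspace :=
  fglift (fun i => coefB (val i) *: basis (val i - 1)).
Definition VE (v : Vspace) : Vspace := VA (VB v) - VB (VA v).

Definition Vchi (x : asl2 K) (v : Vspace) : Vspace :=
  2^-1 *: (x.1 *: VE v + x.2.1 *: VA v + x.2.2 *: VB v).

(* The span of the e_k with k of parity p. *)
Definition Vpart (p : bool) : set Vspace :=
  [set v | forall i, coeff i v != 0 -> odd `|val i|%N = p].

HB.instance Definition _ := GRing.Linear.on VA.
HB.instance Definition _ := GRing.Linear.on VB.

Fact VE_is_linear : linear VE.
Proof.
by move=> c u v; rewrite /VE !linearP /= scalerDr addrACA.
Qed.

HB.instance Definition _ :=
  GRing.isLinear.Build K Vspace Vspace *:%R VE VE_is_linear.

Lemma linear_ext (g h : {linear Vspace -> Vspace}) :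
  (forall k, index_range k -> g (basis k) = h (basis k)) -> g =1 h.
Proof.
move=> gh v; rewrite -(freeg_sumE v) !raddf_sum; apply: eq_bigr => i _ /=.
have -> : << coeff i v *g i >> = coeff i v *: basis (val i) :> Vspace.
  rewrite /basis valK; apply/eqP/freeg_eqP => j.
  by rewrite coeffZ !coeffU mul1r.
by rewrite !linearZ gh //; apply: valP.
Qed.

Lemma basis_out k : ~~ index_range k -> basis k = 0.
Proof. by move=> kN; rewrite /basis insubN. Qed.

Lemma VA_basis k :
  index_range k -> VA (basis k) = coefA k *: basis (k + 1).
Proof. by move=> kr; rewrite {1}/basis insubT /VA liftU scale1r. Qed.

Lemma VB_basis k :
  index_range k -> VB (basis k) = coefB k *: basis (k - 1).
Proof. by move=> kr; rewrite {1}/basis insubT /VB liftU scale1r. Qed.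

Lemma odd_integerP :
  reflect (exists2 m : int, odd `|m|%N & l = m%:~R) odd_integer.
Proof. exact: asboolP. Qed.

Definition ABcoef (k : int) : K := (1 - l) / 2 - (k %/ 2)%Z%:~R.

Lemma ABcoef_odd (m k : int) :
  l = m%:~R -> odd `|m|%N -> (k %/ 2)%Z = ((1 - m) %/ 2)%Z -> ABcoef k = 0.
Proof.
move=> lE om kE; rewrite /ABcoef lE kE.
have -> : (1 - m%:~R : K) = ((1 - m) %/ 2)%Z%:~R * 2.
  rewrite -[2 : K]/(2%:~R) -intrM -[1 : K]/(1%:~R) -intrB; congr (_%:~R); lia.
by rewrite mulfK ?subrr // pnatr_eq0.
Qed.

Lemma VAB_basis k :
  index_range k -> VA (VB (basis k)) = ABcoef k *: basis k.
Proof.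
move=> kr; rewrite VB_basis // linearZ /=.
have [k1r|k1N] := boolP (index_range (k - 1)).
  rewrite VA_basis // scalerA subrK; congr (_ *: _).
  by rewrite /coefA /coefB subrK; case: ifP => _; rewrite ?mul1r ?mulr1.
rewrite (basis_out k1N) linear0 scaler0.
suff -> : ABcoef k = 0 by rewrite scale0r.
move: kr k1N; rewrite /index_range; case: odd_integerP => //= -[m om lE] kr k1N.
apply: (ABcoef_odd lE om); move: kr k1N; rewrite lE ltr0z.
rewrite -[2 : K]/(2%:~R) -!intrB -!intrN !ler_int; case: ifP; lia.
Qed.

Lemma VBA_basis k :
  index_range k -> VB (VA (basis k)) = ABcoef (k + 1) *: basis k.
Proof.
move=> kr; rewrite VA_basis // linearZ /=.
have [k1r|k1N] := boolP (index_range (k + 1)).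
  rewrite VB_basis // scalerA addrK; congr (_ *: _).
  by rewrite /coefA /coefB; case: ifP => _; rewrite ?mul1r ?mulr1.
rewrite (basis_out k1N) linear0 scaler0.
suff -> : ABcoef (k + 1) = 0 by rewrite scale0r.
move: kr k1N; rewrite /index_range; case: odd_integerP => //= -[m om lE] kr k1N.
apply: (ABcoef_odd lE om); move: kr k1N; rewrite lE ltr0z.
rewrite -[2 : K]/(2%:~R) -!intrB -!intrN !ler_int; case: ifP; lia.
Qed.

Lemma VE_basis k : VE (basis k) = (odd `|k|%N)%:R *: basis k.
Proof.
have [kr|/basis_out->] := boolP (index_range k); last first.
  by rewrite linear0 scaler0.
rewrite /VE VAB_basis // VBA_basis // -scalerBl; congr (_ *: _).
rewrite /ABcoef opprB addrC addrA subrK -intrB.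
have -> : (((k + 1) %/ 2)%Z - (k %/ 2)%Z = odd `|k|%N)%R by lia.
by rewrite -pmulrn.
Qed.

Lemma odd_absz1 k : odd `|(k + 1)%R|%N = ~~ odd `|k|%N.
Proof. lia. Qed.

Lemma odd_absz1' k : odd `|(k - 1)%R|%N = ~~ odd `|k|%N.
Proof. lia. Qed.

Lemma VEE v : VE (VE v) = VE v.
Proof.
apply: (@linear_ext (VE \o VE) VE) => k _ /=.
by rewrite VE_basis linearZ /= VE_basis scalerA -natrM mulnb andbb.
Qed.

Lemma VAE v : VA (VE v) + VE (VA v) = VA v.
Proof.
apply: (@linear_ext ((VA \o VE) \+ (VE \o VA)) VA) => k kr /=.
rewrite VE_basis linearZ /= VA_basis // !linearZ /= VE_basis odd_absz1.
by rewrite !scalerA -scalerDl; congr (_ *: _); case: odd => /=; ring.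
Qed.

Lemma VBE v : VB (VE v) + VE (VB v) = VB v.
Proof.
apply: (@linear_ext ((VB \o VE) \+ (VE \o VB)) VB) => k kr /=.
rewrite VE_basis linearZ /= VB_basis // !linearZ /= VE_basis odd_absz1'.
by rewrite !scalerA -scalerDl; congr (_ *: _); case: odd => /=; ring.
Qed.

Fact Vpart_submod p : submod_closed (mem (Vpart p)).
Proof.
split; first by rewrite in_setE => i; rewrite coeff0 eqxx.
move=> c u v; rewrite !in_setE => up vp i; rewrite coeffD coeffZ => nz.
have [ui0|/up//] := eqVneq (coeff i u) 0.
by apply: vp; apply: contraNneq nz => ->; rewrite ui0 mulr0 addr0.
Qed.

Lemma VpartP p c u v : Vpart p u -> Vpart p v -> Vpart p (c *: u + v).
Proof.
by have [_ h] := Vpart_submod p; have := h c u v; rewrite !in_setE.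
Qed.

Lemma Vpart0 p : Vpart p 0.
Proof. by move=> i; rewrite coeff0 eqxx. Qed.

Lemma Vpart_basis k c : Vpart (odd `|k|%N) (c *: basis k).
Proof.
have [kr|/basis_out->] := boolP (index_range k); last first.
  by rewrite scaler0; apply: Vpart0.
rewrite /basis insubT => i; rewrite coeffZ coeffU mul1r.
move=> nz; suff /eqP <- : Sub k kr == i by [].
by apply: contraNT nz => /negPf ->; rewrite mulr0.
Qed.

Lemma freegU_basis c (i : {k : int | index_range k}) :
  << c *g i >> = c *: basis (val i) :> Vspace.
Proof.
rewrite /basis valK; apply/eqP/freeg_eqP => j.
by rewrite coeffZ !coeffU mul1r.
Qed.

Lemma Vpart_shift (g : {linear Vspace -> Vspace}) r :
  (forall k, index_range k -> Vpart (r (+) odd `|k|%N) (g (basis k))) ->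
  forall p v, Vpart p v -> Vpart (r (+) p) (g v).
Proof.
move=> gP p v vp; rewrite -(freeg_sumE v) raddf_sum /= big_seq.
apply: (big_ind (Vpart (r (+) p))) => [|u w uP wP|i].
- exact: Vpart0.
- by rewrite -[u]scale1r; apply: VpartP.
- rewrite mem_dom => /vp <-; rewrite freegU_basis linearZ /= -[_ *: _]addr0.
  by apply: VpartP (gP _ (valP i)) (Vpart0 _).
Qed.

Lemma VE_part p v : Vpart p v -> Vpart p (VE v).
Proof.
apply: (@Vpart_shift VE false) => k _ /=.
by rewrite VE_basis; apply: Vpart_basis.
Qed.

Lemma VA_part p v : Vpart p v -> Vpart (~~ p) (VA v).
Proof.
apply: (@Vpart_shift VA true) => k kr /=.
by rewrite VA_basis // -odd_absz1; apply: Vpart_basis.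
Qed.

Lemma VB_part p v : Vpart p v -> Vpart (~~ p) (VB v).
Proof.
apply: (@Vpart_shift VB true) => k kr /=.
by rewrite VB_basis // -odd_absz1'; apply: Vpart_basis.
Qed.

Fact Vpart_sum v : exists v0 v1,
  [/\ Vpart false v0, Vpart true v1 & v = v0 + v1].
Proof.
have sumP p : Vpart p
    (\sum_(i <- dom v | odd `|val i|%N == p) << coeff i v *g i >>).
  apply: (big_ind (Vpart p)) => [|u w uP wP|i /eqP<-].
  - exact: Vpart0.
  - by rewrite -[u]scale1r; apply: VpartP.
  - by rewrite freegU_basis; apply: Vpart_basis.
exists (\sum_(i <- dom v | odd `|val i|%N == false) << coeff i v *g i >>).
exists (\sum_(i <- dom v | odd `|val i|%N == true) << coeff i v *g i >>).
split=> //; rewrite -{1}(freeg_sumE v).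
rewrite (bigID (fun i => odd `|val i|%N == false)) /=; congr (_ + _).
by apply: eq_bigl => i; case: odd.
Qed.

Fact Vpart_direct v : Vpart false v -> Vpart true v -> v = 0.
Proof.
move=> v0 v1; apply/eqP/freeg_eqP => i; rewrite coeff0; apply/eqP.
by apply: contraT => nz; have := v1 i nz; rewrite (v0 i nz).
Qed.

Fact Vchi_linear_l v : linear (Vchi^~ v).
Proof.
move=> c x y; apply/eqP/freeg_eqP => i.
rewrite /Vchi !(coeffZ, coeffD) /= /GRing.scale /=; ring.
Qed.

Fact Vchi_linear_r x : linear (Vchi x).
Proof.
move=> c u v; apply/eqP/freeg_eqP => i.
rewrite /Vchi !linearP !(coeffZ, coeffD) /=; ring.
Qed.

Fact Vchi_even p q x v :
  asl2_part p x -> Vpart q v -> Vpart (p (+) q) (Vchi x v).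
Proof.
move: x => [s [xa xb]] xp vq; rewrite /Vchi /=.
rewrite -[_ *: _]addr0; apply: VpartP (Vpart0 _).
case: p xp => /= [-> | [-> ->]].
  rewrite scale0r add0r; apply: VpartP; first exact: VA_part.
  by rewrite -[_ *: _]addr0; apply: VpartP (VB_part vq) (Vpart0 _).
rewrite !scale0r !addr0 -[_ *: _]addr0.
exact: VpartP (VE_part vq) (Vpart0 _).
Qed.

Fact Vchi_rel p q x y v : asl2_part p x -> asl2_part q y ->
  Vchi x (Vchi y v) + (-1) ^+ (p && q) *: Vchi y (Vchi x v) =
  Vchi (asl2_mul x y) v.
Proof.
have EA w : VE (VA w) = VA w - VA (VE w).
  by apply/esym/eqP; rewrite subr_eq addrC VAE.
have EB w : VE (VB w) = VB w - VB (VE w).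
  by apply/esym/eqP; rewrite subr_eq addrC VBE.
have AB w : VA (VB w) = VE w + VB (VA w) by rewrite /VE subrK.
have comb (g : {linear Vspace -> Vspace}) c d e f (u w z : Vspace) :
    g (c *: (d *: u + e *: w + f *: z)) =
    c *: (d *: g u + e *: g w + f *: g z).
  by have gZ := linearZZ g; rewrite gZ (linearD g) (linearD g) !gZ.
move: x y => [s [xa xb]] [t [ya yb]] xp yq.
apply/eqP/freeg_eqP => i; rewrite /Vchi /=.
case: p xp => /= [-> | [-> ->]]; case: q yq => /= [-> | [-> ->]];
rewrite !(comb VE, comb VA, comb VB) /= VEE EA EB AB
  !(coeffZ, coeffD, coeffB) /=;
rewrite /GRing.scale /= ?expr0 ?expr1; by field.
Qed.

Definition Vrep : asl2_rep K :=
  @Asl2Rep K Vspace Vpart Vchi Vpart_submod Vpart_sum Vpart_direct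
    Vchi_linear_l Vchi_linear_r Vchi_even Vchi_rel.

Lemma Vrep_opA (v : Vrep) : opA v = VA v.
Proof.
rewrite /opA /= /Vchi /= scalerA mulfV ?pnatr_eq0 // scale1r.
by rewrite !scale0r scale1r add0r addr0.
Qed.

Lemma Vrep_opB (v : Vrep) : opB v = VB v.
Proof.
rewrite /opB /= /Vchi /= scalerA mulfV ?pnatr_eq0 // scale1r.
by rewrite !scale0r scale1r !add0r.
Qed.

End Model.

Section Domain.
Variable R : realType.

Definition real_parameters : set R := [set l | -1 <= l <= 1].

Definition complex_parameters : set R[i] :=
  [set l | exists2 r : R, -1 <= r <= 1 & l = r%:C%C] `|`
  [set l | -1 <= complex.Re l < 1].

End Domain.

(* Main.v *)
Require Import Defs.
From mathcomp Require Import all_boot all_order all_algebra.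
From mathcomp Require Import boolp classical_sets reals.
From mathcomp Require Import complex freeg.
From HB Require Import structures.
From mathcomp Require Import zify ring lra.

(* Since [H, A] = A, [H, B] = -B and E^2 = E, a homogeneous vector which is an
   eigenvector of both E and H generates a chain of weight vectors under A and
   B, on which AB and BA act by scalars determined by the weight. In an
   irreducible V these chains span V. Start from a nonzero w with E w = w and
   H w = l w. If l is not -1, then A^2 w is a nonzero vector of the same kind
   with weight l + 2; if l is not 1, then B^2 w is one with weight l - 2.
   Hence l can be moved into the parameter set. If l is then not an odd
   integer, AB and BA never vanish on the chain, which is therefore that of
   V(l). If l = 1 (resp. -1), then B w (resp. A w) generates a subrepresentation
   without w, so it vanishes and the chain is one-sided. For uniqueness, V(l)
   determines l up to even integers as an eigenvalue of H on the image of E, and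
   V(1), V(-1) are told apart by their ranges of weights. *)

Set Implicit Arguments.
Unset Strict Implicit.
Unset Printing Implicit Defensive.

Import Order.TTheory GRing.Theory Num.Theory.

Local Open Scope classical_set_scope.
Local Open Scope ring_scope.

(** * Submodules as sets, and independence of eigenvectors *)

Section SubmoduleSets.
Variables (K : numFieldType) (M : lmodType K) (W : set M).
Hypothesis WM : submod_closed (mem W).

Lemma submod0 : W 0.
Proof. by have [+ _] := WM; rewrite in_setE. Qed.

Lemma submodP c u v : W u -> W v -> W (c *: u + v).
Proof. by have [_ /(_ c u v)] := WM; rewrite !in_setE. Qed.

Lemma submodZ c u : W u -> W (c *: u).
Proof. by move=> Wu; rewrite -[_ *: _]addr0; apply: submodP submod0. Qed.

Lemma submodD u v : W u -> W v -> W (u + v).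
Proof. by rewrite -{2}[u]scale1r; apply: submodP. Qed.

End SubmoduleSets.

Lemma submod_closedI (K : numFieldType) (M : lmodType K) (W : set M) :
  W 0 -> (forall c u v, W u -> W v -> W (c *: u + v)) -> submod_closed (mem W).
Proof. by move=> W0 WP; split=> [|c u v]; rewrite !in_setE //; apply: WP. Qed.

(** Applying [h - mu j] to the sum kills the term [u j] and multiplies each other term by the
    nonzero scalar [mu i - mu j], which gives a shorter sum. The [u i] may be zero, as happens on
    one-sided chains. *)
Lemma eigen_sum_eq0 (K : numFieldType) (M : lmodType K) (h : {linear M -> M})
    (I : eqType) (mu : I -> K) (u : I -> M) (s : seq I) :
  injective mu -> uniq s -> (forall i, h (u i) = mu i *: u i) ->
  \sum_(i <- s) u i = 0 -> {in s, forall i, u i = 0}.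
Proof.
move=> mu_inj; elim: s u => [|j s IHs] u //= /andP[js us] hu.
rewrite big_cons => sum0.
have us0 : {in s, forall i, u i = 0}.
  move=> i is_; have /eqP : (mu i - mu j) *: u i = 0.
    apply: (IHs (fun i => (mu i - mu j) *: u i)) => // [k|].
      by rewrite linearZ /= hu scalerA mulrC -scalerA.
    have : h (u j + \sum_(k <- s) u k) - mu j *: (u j + \sum_(k <- s) u k) = 0.
      by rewrite sum0 linear0 scaler0 subr0.
    rewrite linearD hu scalerDr opprD addrACA subrr add0r linear_sum.
    rewrite scaler_sumr -sumrB => {2}<-.
    by apply: eq_bigr => k _; rewrite hu scalerBl.
  rewrite scaler_eq0 subr_eq0 => /orP[/eqP/mu_inj ij|/eqP//].
  by rewrite -ij is_ in js.
move=> i; rewrite inE => /orP[/eqP->|/us0//].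
by move: sum0; rewrite big_seq big1 ?addr0.
Qed.

(** * The operators A, B, E and H and their commutation relations *)

Section Operators.
Variables (K : numFieldType) (V : asl2_rep K).
Implicit Types u v w : V.

HB.instance Definition _ x :=
  GRing.isLinear.Build K V V *:%R (chi x) (chi_linear_r x).

Definition opE v : V := 2 *: chi eps v.

Lemma twice_chi_linear x : linear (fun v : V => 2 *: chi x v).
Proof.
by move=> c u v; rewrite linearP scalerDr !scalerA mulrC.
Qed.

HB.instance Definition _ := GRing.isLinear.Build K V V *:%R (@opA K V)
  (twice_chi_linear gen_a).
HB.instance Definition _ := GRing.isLinear.Build K V V *:%R (@opB K V)
  (twice_chi_linear gen_b).
HB.instance Definition _ := GRing.isLinear.Build K V V *:%R opE
  (twice_chi_linear eps).

Let opAP c u v : opA (c *: u + v) = c *: opA u + opA v.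
Proof. exact: (twice_chi_linear gen_a). Qed.
Let opBP c u v : opB (c *: u + v) = c *: opB u + opB v.
Proof. exact: (twice_chi_linear gen_b). Qed.

Lemma opH_linear : linear (@opH K V).
Proof.
move=> c u v; rewrite /opH 2!(opAP, opBP) 2!(opAP, opBP).
by rewrite addrACA -scalerDr opprD scalerN.
Qed.

HB.instance Definition _ := GRing.isLinear.Build K V V *:%R (@opH K V)
  opH_linear.

Lemma chiZl c x v : chi (c *: x) v = c *: chi x v.
Proof.
have chi0 : chi 0 v = 0.
  have := chi_linear_l v (-1) 0 0.
  by rewrite scaler0 addr0 scaleN1r addNr.
by have := chi_linear_l v c x 0; rewrite addr0 chi0 addr0.
Qed.

(** Reduces stability and equivariance under all of [chi] to the operators E, A, B. *)
Lemma chiE x v :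
  chi x v = 2^-1 *: (x.1 *: opE v + x.2.1 *: opA v + x.2.2 *: opB v).
Proof.
have {1}-> : x = x.1 *: eps + (x.2.1 *: gen_a + x.2.2 *: gen_b).
  case: x => s [p q]; congr (_, (_, _)); rewrite /= /GRing.scale /=; ring.
rewrite !(chi_linear_l v) chiZl addrA /opE /opA /opB.
have half c u : 2^-1 *: (c *: (2 *: u)) = c *: u.
  by rewrite !scalerA mulrCA mulVf ?mulr1 ?pnatr_eq0.
by rewrite !scalerDr !half.
Qed.

Let chiZr x c v : chi x (c *: v) = c *: chi x v.
Proof. exact: (linearZZ (chi x)). Qed.

Let twice_half v : 2 *: (2 *: (2^-1 *: v)) = 2 *: v.
Proof. by rewrite !scalerA mulfK ?pnatr_eq0. Qed.

(** This and the next three relations are [chi_rel] on pairs of generators, rescaled to absorb the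
    factors 2 in A, B, E. *)
Lemma opEE v : opE v = opA (opB v) - opB (opA v).
Proof.
have ra : asl2_part true (gen_a : asl2 K) by [].
have rb : asl2_part true (gen_b : asl2 K) by [].
have := chi_rel v ra rb; have [_ _ _ [-> _] _] := asl2_table K.
rewrite chiZl expr1 scaleN1r => /(congr1 (fun u => 2 *: (2 *: u))).
rewrite /opE /opA /opB twice_half !chiZr => <-.
by rewrite -!scalerBr.
Qed.

Lemma opAE v : opA (opE v) = opA v - opE (opA v).
Proof.
have ra : asl2_part true (gen_a : asl2 K) by [].
have re : asl2_part false (eps : asl2 K) by [].
have := chi_rel v ra re; have [_ [_ ->] _ _ _] := asl2_table K.
rewrite chiZl expr0 scale1r => /(congr1 (fun u => 2 *: (2 *: u))).
rewrite /opE /opA /opB twice_half !chiZr => <-.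
by rewrite -!scalerBr addrK.
Qed.

Lemma opBE v : opB (opE v) = opB v - opE (opB v).
Proof.
have rb : asl2_part true (gen_b : asl2 K) by [].
have re : asl2_part false (eps : asl2 K) by [].
have := chi_rel v rb re; have [_ _ [_ ->] _ _] := asl2_table K.
rewrite chiZl expr0 scale1r => /(congr1 (fun u => 2 *: (2 *: u))).
rewrite /opE /opA /opB twice_half !chiZr => <-.
by rewrite -!scalerBr addrK.
Qed.

Lemma opE_idem v : opE (opE v) = opE v.
Proof.
have re : asl2_part false (eps : asl2 K) by [].
have := chi_rel v re re; have [-> _ _ _ _] := asl2_table K.
rewrite /opE expr0 scale1r chiZr => {2}<-.
by rewrite scalerA scalerDr -scalerDl -natrM -natrD.
Qed.

(** Solving AB - BA = E and AB + BA = -H for AB, and below for BA, makes both products scalar on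
    common eigenvectors of E and H. *)
Lemma opAB v : opA (opB v) = 2^-1 *: (opE v - opH v).
Proof.
rewrite opEE /opH opprK addrACA addNr addr0.
by rewrite -mulr2n -scaler_nat scalerA mulVf ?pnatr_eq0 ?scale1r.
Qed.

Lemma opBA v : opB (opA v) = - (2^-1 *: (opE v + opH v)).
Proof.
rewrite opEE /opH opprD addrACA subrr add0r -opprD -mulr2n scalerN opprK.
by rewrite -scaler_nat scalerA mulVf ?pnatr_eq0 ?scale1r.
Qed.

Lemma opAZ c v : opA (c *: v) = c *: opA v.
Proof. exact: (linearZZ (@opA K V)). Qed.

Lemma opBZ c v : opB (c *: v) = c *: opB v.
Proof. exact: (linearZZ (@opB K V)). Qed.

Lemma opEZ c v : opE (c *: v) = c *: opE v.
Proof. exact: (linearZZ opE). Qed.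

Lemma opHZ c v : opH (c *: v) = c *: opH v.
Proof. exact: (linearZZ (@opH K V)). Qed.

(** With H = E - 2AB and BA = AB - E, the commutator HA - AH reduces to EA + AE, which is A. For B,
    the form H = -(E + 2BA) is used instead. *)
Lemma opHA v : opH (opA v) = opA (opH v) + opA v.
Proof.
have BA w : opB (opA w) = opA (opB w) - opE w.
  by rewrite opEE opprB addrC subrK.
have HE w : opH w = opE w - 2 *: opA (opB w).
  by rewrite /opH BA addrA opprB scaler_nat mulr2n.
have AB u w : opA (u - w) = opA u - opA w by exact: (linearB (@opA K V)).
rewrite !HE BA !AB opAZ opAE; set w := opA v - _; set z := opA (opA _).
rewrite -{2}[opA v](subrK (opE (opA v))) -/w.
move: (w) z => {}w z.
rewrite scalerBr opprB [2 *: w]scaler_nat mulr2n addrC -!addrA.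
by congr (_ + _); rewrite addrCA.
Qed.

Lemma opHB v : opH (opB v) = opB (opH v) - opB v.
Proof.
have AB w : opA (opB w) = opB (opA w) + opE w.
  by rewrite opEE addrC subrK.
have HE w : opH w = - (opE w + 2 *: opB (opA w)).
  by rewrite /opH AB addrAC addrC scaler_nat mulr2n.
have BD u w : opB (u + w) = opB u + opB w by exact: (linearD (@opB K V)).
have BN w : opB (- w) = - opB w by exact: (linearN (@opB K V)).
rewrite !HE AB BN !BD opBZ opBE; set w := opB v - _; set z := opB (opB _).
rewrite -{2}[opB v](subrK (opE (opB v))) -/w -opprD.
move: (w) z => {}w z; congr (- _).
rewrite scalerDr [2 *: w]scaler_nat mulr2n [opE _ + _]addrC.
rewrite -!addrA. by rewrite addrCA; congr (_ + _); rewrite addrCA.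
Qed.

Lemma part_chi p q x v :
  asl2_part p x -> part q v -> part (p (+) q) (2 *: chi x v).
Proof.
by move=> xp vq; apply: submodZ; [apply: part_submod | apply: chi_even].
Qed.

Lemma part_opA q v : part q v -> part (~~ q) (opA v).
Proof. exact: (@part_chi true). Qed.

Lemma part_opB q v : part q v -> part (~~ q) (opB v).
Proof. exact: (@part_chi true). Qed.

Lemma part_opE q v : part q v -> part q (opE v).
Proof. exact: (@part_chi false). Qed.

End Operators.

Section Parts.
Variables (K : numFieldType) (V : asl2_rep K) (p : bool).

Lemma part0 : part p (0 : V).
Proof. exact: submod0 (part_submod V p). Qed.

Lemma partZ c (v : V) : part p v -> part p (c *: v).
Proof. exact: (submodZ (part_submod V p)). Qed.

Lemma partP c (u v : V) : part p u -> part p v -> part p (c *: u + v).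
Proof. exact: (submodP (part_submod V p)). Qed.

End Parts.

(** * Weight vectors and the action of A and B on them *)

Section WeightVectors.
Variables (K : numFieldType) (V : asl2_rep K) (l : K) (q : bool).
Implicit Types (k : int) (v w : V).

(* The relations satisfied by w = e_k in V(l), with the grading reversed when
   q is true. *)
Definition weight_vector k w : Prop :=
  [/\ part (q (+) odd `|k|%N) w, opE w = (odd `|k|%N)%:R *: w
    & opH w = (l - 1 + k%:~R) *: w].

Lemma weight_vector0 k : weight_vector k 0.
Proof.
split; first exact: part0.
- by rewrite scaler0 (linear0 (@opE K V)).
- by rewrite scaler0 (linear0 (@opH K V)).
Qed.

Lemma weight_vectorZ k c w : weight_vector k w -> weight_vector k (c *: w).
Proof.
move=> [wp wE wH]; split; first exact: partZ.
- by rewrite opEZ wE !scalerA mulrC.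
- by rewrite opHZ wH !scalerA mulrC.
Qed.

(** AE + EA = A turns the eigenvalue e of E into 1 - e, and [H, A] = A raises the weight by one. *)
Lemma weight_vectorA k w : weight_vector k w -> weight_vector (k + 1) (opA w).
Proof.
move=> [wp wE wH]; split; first by rewrite odd_absz1 addbN; apply: part_opA.
- rewrite odd_absz1; have /eqP := opAE w.
  rewrite wE opAZ eq_sym subr_eq addrC -subr_eq => /eqP <-.
  by rewrite -{1}[opA w]scale1r -scalerBl; case: odd; rewrite ?subrr ?subr0.
- by rewrite opHA wH opAZ -{2}[opA w]scale1r -scalerDl intrD addrA.
Qed.

Lemma weight_vectorB k w : weight_vector k w -> weight_vector (k - 1) (opB w).
Proof.
move=> [wp wE wH]; split; first by rewrite odd_absz1' addbN; apply: part_opB.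
- rewrite odd_absz1'; have /eqP := opBE w.
  rewrite wE opBZ eq_sym subr_eq addrC -subr_eq => /eqP <-.
  by rewrite -{1}[opB w]scale1r -scalerBl; case: odd; rewrite ?subrr ?subr0.
- by rewrite opHB wH opBZ -{2}[opB w]scale1r -scalerBl intrB addrA.
Qed.

(** If e is the parity of k, then AB = (E - H)/2 acts by (e - l + 1 - k)/2, and k - e = 2[k/2]. For
    BA one uses k + e = 2[(k+1)/2]. *)
Lemma weight_vectorAB k w : weight_vector k w -> opA (opB w) = ABcoef l k *: w.
Proof.
move=> [_ wE wH]; rewrite opAB wE wH -scalerBl scalerA; congr (_ *: _).
rewrite /ABcoef; have {2}-> : k = (k %/ 2)%Z * 2 + odd `|k|%N by lia.
by rewrite intrD intrM -pmulrn; field.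
Qed.

Lemma weight_vectorBA k w :
  weight_vector k w -> opB (opA w) = ABcoef l (k + 1) *: w.
Proof.
move=> [_ wE wH]; rewrite opBA wE wH -scalerDl scalerA -scaleNr.
congr (_ *: _); rewrite /ABcoef.
have /(congr1 (fun i : int => i%:~R : K)) :
  k + odd `|k|%N = ((k + 1) %/ 2)%Z * 2 by lia.
rewrite intrD intrM -pmulrn => /eqP.
by rewrite eq_sym -subr_eq => /eqP <-; field.
Qed.

End WeightVectors.

(** Only l + k enters the weight and only the parity of k enters the rest, so an even shift can be
    traded between index and parameter. This brings vectors back to index 1. *)
Lemma weight_vector_shift (K : numFieldType) (V : asl2_rep K) l q (m k : int)
    (w : V) :
  ~~ odd `|m|%N ->
  weight_vector l q (k + m) w -> weight_vector (l + m%:~R) q k w.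
Proof.
move=> m_even; rewrite /weight_vector.
have -> : odd `|(k + m)%R|%N = odd `|k|%N by lia.
by case=> wp wE ->; split=> //; congr (_ *: _); rewrite intrD; ring.
Qed.

(** * Spans of weight chains as subrepresentations *)

(** Being an intersection of submodules, the span comes with an induction principle: a property of
    its elements is proved by exhibiting one submodule containing the generators. *)
Definition span (K : numFieldType) (M : lmodType K) (I : Type) (f : I -> M) :
    set M :=
  [set v | forall W : set M,
    submod_closed (mem W) -> (forall i, W (f i)) -> W v].

Lemma span_submod (K : numFieldType) (M : lmodType K) (I : Type) (f : I -> M) :
  submod_closed (mem (span f)).
Proof.
apply: submod_closedI => [W WM _|c u v uS vS W WM Wf]; first exact: submod0.
by apply: submodP; [|apply: uS|apply: vS].
Qed.

Section Span.
Variables (K : numFieldType) (V : asl2_rep K) (l : K) (q : bool).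
Variable f : int -> V.
Hypothesis f_weight : forall k, weight_vector l q k (f k).
Hypothesis f_opA : forall k, exists c, opA (f k) = c *: f (k + 1).
Hypothesis f_opB : forall k, exists c, opB (f k) = c *: f (k - 1).

Lemma span_gen k : span f (f k).
Proof. by move=> W _; apply. Qed.

Lemma span_subrep : subrep (span f).
Proof.
have SM := span_submod f; split=> // [w wS|x w wS].
  (* Vectors whose homogeneous components lie in the span form a submodule, and it contains each
     [f k] because [f k] is homogeneous. *)
  apply: (wS [set w | exists w0 w1, [/\ span f w0 /\ part false w0,
    span f w1 /\ part true w1 & w = w0 + w1]]); last first.
    move=> k; have [fp _ _] := f_weight k.
    case: (q (+) _) fp => fp; [exists 0, (f k)|exists (f k), 0];
      rewrite ?add0r ?addr0; split=> //; split=> //;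
      by [apply: span_gen|apply: (submod0 SM)|apply: part0].
  apply: submod_closedI => [|c u v].
    by exists 0, 0; rewrite addr0; do !split=> //;
      [apply: (submod0 SM)|apply: part0|
       apply: (submod0 SM)|apply: part0].
  move=> [u0 [u1 [[? ?] [? ?] ->]]] [v0 [v1 [[? ?] [? ?] ->]]].
  exists (c *: u0 + v0), (c *: u1 + v1); split.
  - by split; [apply: (submodP SM)|apply: partP].
  - by split; [apply: (submodP SM)|apply: partP].
  - by rewrite scalerDr addrACA.
apply: (wS [set w | span f (chi x w)]); last first.
  move=> k; rewrite /mkset chiE; apply: (submodZ SM) => //.
  have [_ -> _] := f_weight k; have [a ->] := f_opA k; have [b ->] := f_opB k.
  by rewrite scalerA; do 2?apply: (submodD SM); rewrite -?scalerA //;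
    do 2![apply: (submodZ SM) => //]; apply: span_gen.
apply: submod_closedI => [|c u v]; rewrite /mkset.
  by rewrite (linear0 (chi x)); apply: (submod0 SM).
by rewrite (linearP (chi x)); apply: (submodP SM).
Qed.

Lemma span_full k : irreducible V -> f k != 0 -> forall v, span f v.
Proof.
move=> [_ /(_ _ span_subrep)[S0|ST] fk0 v]; last by rewrite ST.
by have := span_gen k; rewrite S0 /= => fkE; rewrite fkE eqxx in fk0.
Qed.

(* In an irreducible representation, a weight chain avoiding the weight of v
   vanishes, because its span cannot contain v. *)
Lemma gap_eq0 k0 (v : V) : irreducible V -> f k0 = 0 -> v != 0 ->
  weight_vector l q k0 v -> forall k, f k = 0.
Proof.
move=> Virr fk00 v0 [_ _ vH] k; apply/eqP; apply: contraT => fk.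
have : [set v | exists D : {freeg int / K}, v = fglift f D] v.
  apply: (span_full Virr fk) => [|i]; last first.
    by exists << i >>; rewrite liftU scale1r.
  apply: submod_closedI => [|c _ _ [D ->] [D' ->]].
    by exists 0; rewrite linear0.
  by exists (c *: D + D'); rewrite linearP.
(* The relation v = sum of [coeff i D *: f i] becomes a vanishing sum of eigenvectors of distinct
   weights. The term of D at [k0] is lost harmlessly since [f k0 = 0]. *)
move=> [D vE]; pose u i := if i == k0 then v else - (coeff i D *: f i).
suff : u k0 = 0 by rewrite /u eqxx => vz; rewrite vz eqxx in v0.
have mu_inj : injective (fun i : int => l - 1 + i%:~R : K).
  by move=> i j /addrI /intr_inj.
have sumD : \sum_(i <- dom D | i != k0) u i = - v.
  rewrite vE -{2}(freeg_sumE D) raddf_sum -sumrN big_mkcond /=.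
  apply: eq_bigr => i _; rewrite liftU /u.
  by case: eqVneq => //= ->; rewrite fk00 scaler0 oppr0.
apply: (eigen_sum_eq0 (h := @opH K V) mu_inj
  (s := k0 :: [seq i <- dom D | i != k0]) (u := u)) => [|i||].
- by rewrite /= mem_filter eqxx /= filter_uniq ?uniq_dom.
- rewrite /u; case: eqP => [->//|_]; have [_ _ fH] := f_weight i.
  by rewrite -scaleNr -[LHS]/(opH _) opHZ fH !scalerA mulrC.
- by rewrite big_cons big_filter sumD /u eqxx subrr.
- by rewrite inE eqxx.
Qed.

End Span.

(** * From a normalized chain to an isomorphism with V(l) *)

Section ChainIsomorphism.
Variables (K : numFieldType) (V : asl2_rep K) (l : K) (q : bool).
Variable f : int -> V.
Hypothesis Virr : irreducible V.
Hypothesis f_weight : forall k, weight_vector l q k (f k).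
Hypothesis f_support : forall k, (f k != 0) = index_range l k.
Hypothesis f_opA :
  forall k, index_range l k -> opA (f k) = coefA l k *: f (k + 1).
Hypothesis f_opB :
  forall k, index_range l k -> opB (f k) = Defs.coefB l k *: f (k - 1).

Let Phi : {linear Vspace l -> V} :=
  fglift (fun i : {k | index_range l k} => f (val i)).

Let f_out k : ~~ index_range l k -> f k = 0.
Proof. by rewrite -f_support negbK => /eqP. Qed.

Let Phi_basis k : Phi (basis l k) = f k.
Proof.
have [kr|kN] := boolP (index_range l k).
  by rewrite /basis insubT /= liftU scale1r.
by rewrite basis_out // linear0 f_out.
Qed.

Let Phi_ext (g h : {linear Vspace l -> V}) :
  (forall k, index_range l k -> g (basis l k) = h (basis l k)) -> g =1 h.
Proof.
move=> gh v; rewrite -(freeg_sumE v) !raddf_sum; apply: eq_bigr => i _ /=.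
by rewrite freegU_basis !linearZ gh //; apply: valP.
Qed.

Let PhiA v : Phi (VA v) = opA (Phi v).
Proof.
apply: (@Phi_ext (Phi \o @VA K l) (@opA K V \o Phi)) => k kr.
rewrite [LHS]/= VA_basis // linearZZ Phi_basis -f_opA //.
by rewrite /= -/(Phi _) Phi_basis.
Qed.

Let PhiB v : Phi (VB v) = opB (Phi v).
Proof.
apply: (@Phi_ext (Phi \o @VB K l) (@opB K V \o Phi)) => k kr.
rewrite [LHS]/= VB_basis // linearZZ Phi_basis -f_opB //.
by rewrite /= -/(Phi _) Phi_basis.
Qed.

Let Phi_chi x v : Phi (Vchi x v) = chi x (Phi v).
Proof.
have PZ c u : Phi (c *: u) = c *: Phi u by exact: linearZZ.
have PD u u' : Phi (u + u') = Phi u + Phi u' by exact: linearD.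
have PB u u' : Phi (u - u') = Phi u - Phi u' by exact: linearB.
by rewrite chiE opEE /Vchi PZ !PD !PZ /VE PB !(PhiA, PhiB).
Qed.

(** The images [f k] of the basis vectors are nonzero and have distinct weights, hence are
    independent. *)
Let Phi_inj : injective Phi.
Proof.
apply/raddf_inj => v Phiv; apply/eqP; rewrite -dom_eq0.
case dv : (dom v) => [//|i s].
have iv : i \in dom v by rewrite dv inE eqxx.
have mu_inj : injective (fun i : {k | index_range l k} => l - 1 + (val i)%:~R).
  by move=> j j' /addrI /intr_inj /val_inj.
have : coeff i v *: f (val i) = 0.
  apply: (eigen_sum_eq0 (h := @opH K V) mu_inj (uniq_dom v)
    (u := fun i => coeff i v *: f (val i))) iv => [j|].
    by have [_ _ fH] := f_weight (val j); rewrite -[LHS]/(opH _) opHZ fH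
      !scalerA mulrC.
  rewrite -[RHS]Phiv -[in RHS](freeg_sumE v) raddf_sum.
  by apply: eq_bigr => j _; rewrite /= liftU.
move/eqP; rewrite scaler_eq0 => /orP[ci0|]; first by rewrite mem_dom ci0 in iv.
by apply/contraTT => _; rewrite f_support; apply: valP.
Qed.

(** The image of [Phi] contains the span of the chain, which is all of V by irreducibility; [k0]
    supplies a nonzero chain vector. *)
Lemma chain_isomorphic k0 : index_range l k0 -> isomorphic V (Vrep l).
Proof.
move=> k0r; have Phi_surj w : exists v, Phi v = w.
  have fk0 : f k0 != 0 by rewrite f_support.
  have SA k : exists c, opA (f k) = c *: f (k + 1).
    have [/f_opA|/f_out->] := boolP (index_range l k).
      by exists (coefA l k).
    by exists 0; rewrite (linear0 (@opA K V)) scale0r.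
  have SB k : exists c, opB (f k) = c *: f (k - 1).
    have [/f_opB|/f_out->] := boolP (index_range l k).
      by exists (Defs.coefB l k).
    by exists 0; rewrite (linear0 (@opB K V)) scale0r.
  have /(_ [set w | exists v, Phi v = w]) :=
    span_full f_weight SA SB Virr fk0 w.
  apply=> [|k].
    apply: submod_closedI => [|c _ _ [v <-] [v' <-]].
      by exists 0; rewrite linear0.
    by exists (c *: v + v'); rewrite linearP.
  by exists (basis l k).
(* [Phi] goes from V(l) to V, so the required map is its inverse. *)
have [g Phig] := choice Phi_surj.
have gPhi : cancel Phi g by move=> v; apply: Phi_inj; rewrite Phig.
have gL := GRing.isLinear.Build K V (Vspace l) *:%R g (can2_linear gPhi Phig).
pose G : {linear V -> Vspace l} := HB.pack (g : V -> Vspace l) gL.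
exists G; split; first by exists Phi.
by move=> x v; apply: Phi_inj; rewrite [RHS](Phi_chi x (g v)) /= !Phig.
Qed.

End ChainIsomorphism.

(** * The two half-chains generated by a weight vector *)

Section Chains.
Variables (K : numFieldType) (V : asl2_rep K) (l : K) (q : bool) (w : V).
Implicit Types k : int.
Hypothesis w_weight : weight_vector l q 1 w.

(** Both half-chains start from w at index 1. The absolute values make them total; [chainA] is
    meaningful for k >= 1 and [chainB] for k <= 1. *)
Definition chainA (k : int) : V := iter `|k - 1|%N (@opA K V) w.
Definition chainB (k : int) : V := iter `|1 - k|%N (@opB K V) w.

Lemma chainAS k : 1 <= k -> chainA (k + 1) = opA (chainA k).
Proof.
by move=> k1; rewrite /chainA -iterS; congr (iter _ _ _); lia.
Qed.

Lemma chainBP k : k <= 1 -> chainB (k - 1) = opB (chainB k).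
Proof.
by move=> k1; rewrite /chainB -iterS; congr (iter _ _ _); lia.
Qed.

Lemma chainA_weight k : 1 <= k -> weight_vector l q k (chainA k).
Proof.
move=> k1; have {k1} -> : k = 1 + `|k - 1|%N%:Z by lia.
elim: `|k - 1|%N => [|n IHn]; first by rewrite addr0.
have -> : 1 + n.+1%:Z = 1 + n%:Z + 1 by lia.
by rewrite chainAS; [apply: weight_vectorA|lia].
Qed.

Lemma chainB_weight k : k <= 1 -> weight_vector l q k (chainB k).
Proof.
move=> k1; have {k1} -> : k = 1 - `|1 - k|%N%:Z by lia.
elim: `|1 - k|%N => [|n IHn]; first by rewrite subr0.
have -> : 1 - n.+1%:Z = 1 - n%:Z - 1 by lia.
by rewrite chainBP; [apply: weight_vectorB|lia].
Qed.

Lemma opB_chainA k :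
  1 <= k -> opB (chainA (k + 1)) = ABcoef l (k + 1) *: chainA k.
Proof.
by move=> k1; rewrite chainAS // (weight_vectorBA (chainA_weight k1)).
Qed.

Lemma opA_chainB k : k <= 1 -> opA (chainB (k - 1)) = ABcoef l k *: chainB k.
Proof.
by move=> k1; rewrite chainBP // (weight_vectorAB (chainB_weight k1)).
Qed.

(** B maps each term back to a nonzero multiple of the preceding one, so no term can be the first to
    vanish. *)
Lemma chainA_neq0 k : w != 0 -> (forall i : int, 2 <= i -> ABcoef l i != 0) ->
  1 <= k -> chainA k != 0.
Proof.
move=> w0 c0 k1; have {k1} -> : k = 1 + `|k - 1|%N%:Z by lia.
elim: `|k - 1|%N => [|n]; first by rewrite addr0.
have -> : 1 + n.+1%:Z = 1 + n%:Z + 1 by lia.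
apply: contra_neq => cz; have := @opB_chainA (1 + n%:Z) _.
rewrite cz (linear0 (@opB K V)) => /(_ _)/esym/eqP.
by rewrite scaler_eq0 (negPf (c0 _ _)) /= => [/(_ _)/eqP->//|]; lia.
Qed.

Lemma chainB_neq0 k : w != 0 -> (forall i : int, i <= 1 -> ABcoef l i != 0) ->
  k <= 1 -> chainB k != 0.
Proof.
move=> w0 c0 k1; have {k1} -> : k = 1 - `|1 - k|%N%:Z by lia.
elim: `|1 - k|%N => [|n]; first by rewrite subr0.
have -> : 1 - n.+1%:Z = 1 - n%:Z - 1 by lia.
apply: contra_neq => cz; have := @opA_chainB (1 - n%:Z) _.
rewrite cz (linear0 (@opA K V)) => /(_ _)/esym/eqP.
by rewrite scaler_eq0 (negPf (c0 _ _)) /= => [/(_ _)/eqP->//|]; lia.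
Qed.

End Chains.

(** * Identification of V with V(l) from a weight l *)

Section Classification.
Variable K : numFieldType.
Implicit Types (V : asl2_rep K) (l : K) (k : int).

(** A zero would give l = 1 - 2[k/2], an odd integer. *)
Lemma ABcoef_neq0 l k : ~~ odd_integer l -> ABcoef l k != 0.
Proof.
apply: contra => /eqP; rewrite /ABcoef => /eqP; rewrite subr_eq0 => /eqP lk.
apply/odd_integerP; exists (1 - (k %/ 2)%Z * 2); first lia.
by rewrite intrB intrM -lk -[2%:~R]/(2 : K); field.
Qed.

Lemma ABcoef1 k : ABcoef 1 k = - (k %/ 2)%Z%:~R :> K.
Proof. by rewrite /ABcoef subrr mul0r sub0r. Qed.

Lemma ABcoefN1 k : ABcoef (- 1) k = (1 - (k %/ 2)%Z)%:~R :> K.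
Proof. by rewrite /ABcoef opprK intrB; field. Qed.

(** At index 1 the conditions are E w = w and H w = l w for a homogeneous w; q allows either
    parity. *)
Definition has_weight V l : Prop :=
  exists q (w : V), w != 0 /\ weight_vector l q 1 w.

(** BA acts on w and on A w by the same scalar -(l + 1)/2, because [2/2] = [3/2]. So A^2 w = 0 would
    force A w = 0 and then w = 0. *)
Lemma has_weight_up V l : has_weight V l -> l != -1 -> has_weight V (l + 2).
Proof.
move=> [q [w [w0 ww]]] l1; have cE : ABcoef l 2 = - (l + 1) / 2.
  by rewrite /ABcoef (_ : (2 %/ 2)%Z = 1) //; field.
have c0 : ABcoef l 2 != 0.
  by rewrite cE mulf_neq0 ?invr_eq0 ?pnatr_eq0 // oppr_eq0 addr_eq0.
have Aw := weight_vectorA ww; have AAw := weight_vectorA Aw.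
exists q, (opA (opA w)); split; last first.
  exact: (@weight_vector_shift _ _ _ _ 2 1).
have BA : opB (opA w) = ABcoef l 2 *: w := weight_vectorBA ww.
have BAA : opB (opA (opA w)) = ABcoef l 2 *: opA w := weight_vectorBA Aw.
apply: contra_neq w0 => AA0; have Aw0 : opA w = 0.
  apply/eqP; move: BAA; rewrite AA0 (linear0 (@opB K V)) => /esym/eqP.
  by rewrite scaler_eq0 (negPf c0).
apply/eqP; move: BA; rewrite Aw0 (linear0 (@opB K V)) => /esym/eqP.
by rewrite scaler_eq0 (negPf c0).
Qed.

(** Likewise AB acts on w and on B w by (1 - l)/2, because [1/2] = [0/2]. *)
Lemma has_weight_down V l : has_weight V l -> l != 1 -> has_weight V (l - 2).
Proof.
move=> [q [w [w0 ww]]] l1; have cE : ABcoef l 1 = - (l - 1) / 2.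
  by rewrite /ABcoef (_ : (1 %/ 2)%Z = 0) //; field.
have c0 : ABcoef l 1 != 0.
  by rewrite cE mulf_neq0 ?invr_eq0 ?pnatr_eq0 // oppr_eq0 subr_eq0.
have Bw := weight_vectorB ww; have BBw := weight_vectorB Bw.
exists q, (opB (opB w)); split; last first.
  exact: (@weight_vector_shift _ _ _ _ (-2) 1).
have AB : opA (opB w) = ABcoef l 1 *: w := weight_vectorAB ww.
have ABB : opA (opB (opB w)) = ABcoef l 1 *: opB w.
  by rewrite (weight_vectorAB Bw) /ABcoef.
apply: contra_neq w0 => BB0; have Bw0 : opB w = 0.
  apply/eqP; move: ABB; rewrite BB0 (linear0 (@opA K V)) => /esym/eqP.
  by rewrite scaler_eq0 (negPf c0).
apply/eqP; move: AB; rewrite Bw0 (linear0 (@opA K V)) => /esym/eqP.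
by rewrite scaler_eq0 (negPf c0).
Qed.

Lemma isomorphic_nonodd V l : irreducible V -> ~~ odd_integer l ->
  has_weight V l -> isomorphic V (Vrep l).
Proof.
move=> Virr lN [q [w [w0 ww]]].
(* For k <= 1, applying A 1 - k times to [chainB w k] gives [c k *: w]. Dividing by [c k] normalizes
   the lower half so that A e_k = e_(k+1). *)
pose c k := \prod_(i < `|1 - k|%N) ABcoef l (1 - i%:Z).
have cP k : k <= 1 -> c (k - 1) = c k * ABcoef l k.
  move=> k1; rewrite /c.
  have -> : `|(1 - (k - 1))%R|%N = `|(1 - k)%R|.+1%N by lia.
  by rewrite big_ord_recr /=; congr (_ * ABcoef l _); lia.
have c0 k : c k != 0 by apply/prodf_neq0 => i _; apply: ABcoef_neq0.
pose f k := if 1 <= k then chainA w k else (c k)^-1 *: chainB w k.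
(* The two halves of [f] agree at k = 1, where [c] is an empty product. *)
have fE k : k <= 1 -> f k = (c k)^-1 *: chainB w k.
  rewrite /f; case: ifP => // k1 k1'; have -> : k = 1 by lia.
  by rewrite /c big_ord0 invr1 scale1r.
have kr k : index_range l k by rewrite /index_range lN.
have A0 k : coefA l k = 1 by rewrite /coefA (negPf lN).
have B0 k : Defs.coefB l k = ABcoef l k by rewrite /Defs.coefB (negPf lN).
apply: (@chain_isomorphic _ _ _ q f) (kr 0) => // k.
- rewrite /f; case: ifP => k1; first exact: chainA_weight.
  by apply: weight_vectorZ; apply: (chainB_weight ww); lia.
- rewrite kr /f; case: ifP => k1.
    by apply: (chainA_neq0 ww) => // i _; apply: ABcoef_neq0.
  rewrite scaler_eq0 invr_eq0 (negPf (c0 k)) /=.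
  by apply: (chainB_neq0 ww) => [//|i _|]; [apply: ABcoef_neq0|lia].
- rewrite A0 scale1r => _; have [k1|k1] := lerP 1 k.
    by rewrite /f k1 ifT ?chainAS //; lia.
  have k1' : k + 1 <= 1 by lia.
  rewrite fE ?ltW // opAZ fE // -{2}[k](addrK 1) (opA_chainB ww) // scalerA.
  by rewrite -[in c k](addrK 1 k) cP // invfM mulfVK ?ABcoef_neq0.
- rewrite B0 => _; have [k1|k1] := lerP k 1.
    rewrite !fE ?opBZ -?chainBP //; last lia.
    by rewrite scalerA cP // invfM mulrCA divff ?mulr1 ?ABcoef_neq0.
  rewrite /f !ifT; [|lia|lia].
  by rewrite -{1 3}[k](subrK 1) (opB_chainA ww) ?subrK //; lia.
Qed.

Lemma odd_integer1 : odd_integer (1 : K).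
Proof. by apply/odd_integerP; exists 1. Qed.

Lemma odd_integerN1 : odd_integer (- 1 : K).
Proof. by apply/odd_integerP; exists (- 1). Qed.

Lemma index_range1 k : index_range (1 : K) k = (1 <= k).
Proof.
rewrite /index_range odd_integer1 ltr01 /=.
have -> : (2 - 1 : K) = 1%:~R by ring.
by rewrite ler_int.
Qed.

Lemma index_rangeN1 k : index_range (- 1 : K) k = (k <= 1).
Proof.
by rewrite /index_range odd_integerN1 ltr0N1 opprK -[1]/(1%:~R) ler_int.
Qed.

Lemma isomorphic_pos1 V : irreducible V ->
  has_weight V 1 -> isomorphic V (Vrep 1).
Proof.
move=> Virr [q [w [w0 ww]]]; have Bw0 : opB w = 0.
  (* The chain of B w, cut off above index 0; it misses the weight of w, so it must vanish. *)
  pose g k := if k <= 0 then chainB w k else 0.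
  have g_weight k : weight_vector 1 q k (g k).
    rewrite /g; case: ifP => k0; last exact: weight_vector0.
    by apply: chainB_weight => //; lia.
  have := @gap_eq0 _ _ _ _ g g_weight _ _ 1 w Virr erefl w0 ww 0.
  rewrite /g lexx; apply=> k.
    have [k0|k0] := boolP (k + 1 <= 0).
      exists (ABcoef 1 (k + 1)); rewrite ifT; last lia.
      by rewrite -{1}[k](addrK 1) (opA_chainB ww) //; lia.
    exists 0; rewrite scale0r; case: ifP => [k0'|_]; last exact: linear0.
    (* The cut is stable: A B w = 0 because [ABcoef 1 1] = -[1/2] = 0. *)
    have -> : k = 1 - 1 by lia.
    by rewrite (opA_chainB ww) // ABcoef1 oppr0 scale0r.
  case: ifP => k0; last by exists 0; rewrite (linear0 (@opB K V)) scale0r.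
  by exists 1; rewrite ifT ?chainBP ?scale1r //; lia.
pose f k := if 1 <= k then chainA w k else 0.
have A1 k : coefA (1 : K) k = 1 by rewrite /coefA ltr10 andbF.
have B1 k : Defs.coefB (1 : K) k = ABcoef 1 k.
  by rewrite /Defs.coefB ltr10 andbF.
apply: (@chain_isomorphic _ _ _ q f Virr _ _ _ _ 1);
  rewrite ?index_range1 // => k.
- rewrite /f; case: ifP => k1; first exact: chainA_weight.
  exact: weight_vector0.
- rewrite index_range1 /f; case: ifP => k1; last by rewrite eqxx.
  apply: (chainA_neq0 ww) => // i i2.
  by rewrite ABcoef1 oppr_eq0 intr_eq0; lia.
- by rewrite index_range1 A1 /f scale1r => k1; rewrite k1 ifT ?chainAS //; lia.
- rewrite index_range1 B1 /f => k1; rewrite k1; case: ifP => k2.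
    by rewrite -{1 2}[k](subrK 1) (opB_chainA ww).
  have -> : k = 1 by lia.
  by rewrite scaler0.
Qed.

Lemma isomorphic_neg1 V : irreducible V ->
  has_weight V (- 1) -> isomorphic V (Vrep (- 1)).
Proof.
move=> Virr [q [w [w0 ww]]]; have Aw0 : opA w = 0.
  (* The mirror image: the chain of A w, stable because B A w is a multiple of [ABcoef (-1) 2] = 1 -
     [2/2] = 0. *)
  pose g k := if 2 <= k then chainA w k else 0.
  have g_weight k : weight_vector (-1) q k (g k).
    rewrite /g; case: ifP => k2; last exact: weight_vector0.
    by apply: chainA_weight => //; lia.
  have := @gap_eq0 _ _ _ _ g g_weight _ _ 1 w Virr erefl w0 ww 2.
  rewrite /g lexx; apply=> k.
    case: ifP => k0; last by exists 0; rewrite (linear0 (@opA K V)) scale0r.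
    by exists 1; rewrite ifT ?chainAS ?scale1r //; lia.
  have [k0|k0] := boolP (2 <= k - 1).
    exists (ABcoef (-1) k); rewrite ifT; last lia.
    by rewrite -{1 2}[k](subrK 1) (opB_chainA ww) //; lia.
  exists 0; rewrite scale0r; case: ifP => [k0'|_]; last exact: linear0.
  have -> : k = 1 + 1 by lia.
  by rewrite (opB_chainA ww) // ABcoefN1 scale0r.
pose f k := if k <= 1 then chainB w k else 0.
have A1 k : coefA (- 1 : K) k = ABcoef (- 1) (k + 1).
  by rewrite /coefA odd_integerN1 ltrN10.
have B1 k : Defs.coefB (- 1 : K) k = 1.
  by rewrite /Defs.coefB odd_integerN1 ltrN10.
apply: (@chain_isomorphic _ _ _ q f Virr _ _ _ _ 1);
  rewrite ?index_rangeN1 // => k.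
- rewrite /f; case: ifP => k1; first exact: chainB_weight.
  exact: weight_vector0.
- rewrite index_rangeN1 /f; case: ifP => k1; last by rewrite eqxx.
  apply: (chainB_neq0 ww) => // i i1.
  by rewrite ABcoefN1 intr_eq0; lia.
- rewrite index_rangeN1 A1 /f => k1; rewrite k1; case: ifP => k2.
    by rewrite -{1}[k](addrK 1) (opA_chainB ww).
  have -> : k = 1 by lia.
  by rewrite scaler0.
- by rewrite index_rangeN1 B1 /f scale1r => k1; rewrite k1 ifT ?chainBP //; lia.
Qed.

End Classification.

(** * Existence of a homogeneous weight vector fixed by E *)

Section Existence.
Variables (K : numFieldType) (V : asl2_rep K).
Implicit Types v u w : V.

(** A and B shift weights by opposite amounts, so H commutes with AB and BA. *)
Lemma opHE v : opH (opE v) = opE (opH v).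
Proof.
have HB u w : opH (u - w) = opH u - opH w by exact: (linearB (@opH K V)).
have AB u w : opA (u - w) = opA u - opA w by exact: (linearB (@opA K V)).
have BD u w : opB (u + w) = opB u + opB w by exact: (linearD (@opB K V)).
by rewrite opEE HB opHA opHB AB subrK opHB opHA BD addrK -opEE.
Qed.

Lemma part_opH p v : part p v -> part p (opH v).
Proof.
move=> vp; rewrite /opH -scaleN1r; apply: partZ; rewrite -[opA _]scale1r.
have nn : ~~ (~~ p) = p by rewrite negbK.
by apply: partP; rewrite -nn; [apply/part_opA/part_opB|apply/part_opB/part_opA].
Qed.

Lemma homogeneous_eigenvector m v : v != 0 -> opH v = m *: v ->
  exists p u, [/\ u != 0, part p u & opH u = m *: u].
Proof.
have [v0 [v1 [v0p v1p ->]]] := part_sum v => vn0.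
have -> : opH (v0 + v1) = opH v0 + opH v1 by exact: (linearD (@opH K V)).
rewrite scalerDr => /eqP; rewrite -subr_eq0 opprD addrACA addr_eq0 => /eqP H01.
have dp p u : part p u -> part p (opH u - m *: u).
  by move=> up; rewrite addrC -scaleNr; apply: partP (part_opH up).
(* As H is even, the eigenvector defects of [v0] and [v1] are opposite vectors lying in
   complementary parts. *)
have d0 : opH v0 - m *: v0 = 0.
  apply: part_direct; first exact: dp.
  by rewrite H01 -scaleN1r; apply/partZ/dp.
move: H01; rewrite d0 => /esym/eqP; rewrite oppr_eq0 subr_eq0 => /eqP H1.
move/eqP: d0; rewrite subr_eq0 => /eqP H0.
have [v00|v0n] := eqVneq v0 0; last by exists false, v0.
by exists true, v1; split=> //; move: vn0; rewrite v00 add0r.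
Qed.

(** For a homogeneous H-eigenvector u, one of E u, A u, B u serves unless all three vanish. In that
    case K u is a subrepresentation, so V would be a line. *)
Lemma exists_weight : infinite_dimensional V -> irreducible V -> weighted V ->
  exists l, has_weight V l.
Proof.
move=> Vinf Virr [m [v [v0 /(homogeneous_eigenvector v0)]]].
move=> [p [u [u0 up uH]]]; have [Eu0|Eu] := eqVneq (opE u) 0; last first.
  exists m, (~~ p), (opE u); split=> //; split.
  - by rewrite addbT negbK; apply: part_opE.
  - by rewrite opE_idem scale1r.
  - by rewrite opHE uH opEZ subrK.
(* E u = 0 places u at an even index; index 0 with parameter m + 1 has weight m. *)
have uw : weight_vector (m + 1) p 0 u.
  by split; rewrite ?addbF ?scale0r ?addrK ?addr0.
have [Au|Au] := eqVneq (opA u) 0; last first.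
  by exists (m + 1), p, (opA u); split; last exact: weight_vectorA uw.
have [Bu|Bu] := eqVneq (opB u) 0; last first.
  exists (m + 1 + (-2)%:~R), p, (opB u); split=> //.
  exact/weight_vector_shift/(weight_vectorB uw).
(* The line K u is treated as a chain concentrated at index 0. *)
pose f (k : int) := if k == 0 then u else 0.
have fw k : weight_vector (m + 1) p k (f k).
  by rewrite /f; case: eqP => [->//|_]; apply: weight_vector0.
have fA k : exists c, opA (f k) = c *: f (k + 1).
  exists 0; rewrite /f scale0r; case: eqP => // _.
  exact: (linear0 (@opA K V)).
have fB k : exists c, opB (f k) = c *: f (k - 1).
  exists 0; rewrite /f scale0r; case: eqP => // _.
  exact: (linear0 (@opB K V)).
case: Vinf; exists 1%N, (fun=> u) => w.
have /(_ [set w | exists c, w = c *: u]) :=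
  span_full fw fA fB (k := 0) Virr u0 w.
case=> [|k|c ->]; last by exists (fun=> c); rewrite big_ord1.
  apply: submod_closedI => [|c _ _ [a ->] [b ->]].
    by exists 0; rewrite scale0r.
  by exists (c * a + b); rewrite scalerDl scalerA.
rewrite /f; case: eqP => _; first by exists 1; rewrite scale1r.
by exists 0; rewrite scale0r.
Qed.

End Existence.

(** * Reading the parameter off V(l) *)

Section Uniqueness.
Variable K : numFieldType.
Implicit Type V : asl2_rep K.

Lemma coeff_diagonal (l : K) (g : {linear Vspace l -> Vspace l})
    (d : int -> K) :
  (forall k, index_range l k -> g (basis l k) = d k *: basis l k) ->
  forall i v, coeff i (g v) = d (val i) * coeff i v.
Proof.
move=> gd i v; rewrite -(freeg_sumE v) !raddf_sum mulr_sumr.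
apply: eq_bigr => j _; rewrite /= freegU_basis linearZ /= gd ?(valP j) //.
have cb : coeff i (basis l (val j)) = (j == i)%:R.
  by rewrite -[basis _ _]scale1r -freegU_basis coeffU mul1r.
rewrite !coeffZ cb; case: eqVneq => [->|_]; last by rewrite !mulr0.
by rewrite mulrCA.
Qed.

Lemma Vrep_opE (l : K) (v : Vrep l) : opE v = VE v.
Proof. by rewrite opEE !Vrep_opA !Vrep_opB. Qed.

Lemma Vrep_opH_basis (l : K) k : index_range l k ->
  opH (basis l k : Vrep l) = (l - 1 + k%:~R) *: basis l k.
Proof.
move=> kr; rewrite /opH !(Vrep_opA, Vrep_opB) VAB_basis // VBA_basis //.
rewrite -scalerDl -scaleNr; congr (_ *: _); rewrite /ABcoef.
have {3}-> : k = (k %/ 2)%Z + ((k + 1) %/ 2)%Z by lia.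
by rewrite intrD; field.
Qed.

(** E and H are diagonal in the basis e_k, so comparing coefficients at any index in the support of
    u gives its parity and weight. *)
Lemma Vrep_eigen (l m : K) (u : Vrep l) : u != 0 -> opE u = u ->
  opH u = m *: u ->
  exists k, [/\ index_range l k, odd `|k|%N & m = l - 1 + k%:~R].
Proof.
move=> u0 uE uH; case du : (dom (u : Vspace l)) => [|i s].
  by move/eqP: du; rewrite dom_eq0 (negPf u0).
have : i \in dom (u : Vspace l) by rewrite du inE eqxx.
rewrite mem_dom => ci; exists (val i); split; first exact: valP.
  have := coeff_diagonal (g := @VE K l) (fun k _ => VE_basis l k) i u.
  rewrite -[X in X = _]/(coeff i (VE u)) -Vrep_opE uE => /eqP.
  by case: odd => //; rewrite mul0r (negPf ci).
pose H : Vspace l -> Vspace l := @opH K (Vrep l).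
have HL := GRing.isLinear.Build K _ _ *:%R H (@opH_linear K (Vrep l)).
pose HB : {linear Vspace l -> Vspace l} := HB.pack H HL.
have := coeff_diagonal (g := HB) (@Vrep_opH_basis l) i u.
by rewrite -[X in X = _]/(coeff i (opH u)) uH coeffZ => /(mulIf ci).
Qed.

(** The vector e_1 of V(l), with E e_1 = e_1 and H e_1 = l e_1, is carried through V into V(l'). *)
Lemma isomorphic_weight V (l l' : K) : index_range l 1 ->
  isomorphic V (Vrep l) -> isomorphic V (Vrep l') ->
  exists k, [/\ index_range l' k, odd `|k|%N & l = l' - 1 + k%:~R].
Proof.
move=> lr [P [[g gP Pg] Pchi]] [P' [[g' gP' Pg'] P'chi]].
have morA (W : asl2_rep K) (Q : {linear V -> W}) :
    (forall x v, Q (chi x v) = chi x (Q v)) ->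
    (forall v, Q (opA v) = opA (Q v)) * (forall v, Q (opB v) = opB (Q v)).
  by move=> Qchi; split=> v; rewrite /opA /opB linearZ /= Qchi.
have morE (W : asl2_rep K) (Q : {linear V -> W}) :
    (forall x v, Q (chi x v) = chi x (Q v)) ->
    (forall v, Q (opE v) = opE (Q v)) * (forall v, Q (opH v) = opH (Q v)).
  move=> /morA[QA QB]; split=> v.
    by rewrite !opEE linearB /= !(QA, QB).
  by rewrite /opH linearN linearD /= !(QA, QB).
have [PE PH] := morE _ _ Pchi; have [P'E P'H] := morE _ _ P'chi.
pose v := g (basis l 1).
have vE : opE v = v.
  by apply: (can_inj gP); rewrite PE Pg Vrep_opE VE_basis scale1r.
have vH : opH v = l *: v.
  apply: (can_inj gP).
  by rewrite PH Pg Vrep_opH_basis // subrK linearZZ Pg.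
apply: (@Vrep_eigen l' l (P' v)).
- apply: contraTneq isT => P'v0.
  have v0 : v = 0 by apply: (can_inj gP'); rewrite P'v0 linear0.
  have : basis l 1 = 0 by rewrite -(Pg (basis l 1)) -/v v0 linear0.
  by rewrite /basis insubT /= => /eqP; rewrite freegU_eq0 oner_eq0.
- by rewrite -P'E vE.
- by rewrite -P'H vH linearZZ.
Qed.

End Uniqueness.

(** * The parameter set, for the real and complex cases at once *)

Section ParameterSet.
Variables (R : realType) (K : numFieldType) (re : K -> R).
Hypothesis re0 : re 0 = 0.
Hypothesis reD : forall x (m : int), re (x + m%:~R) = re x + m%:~R.

(* Both parameter sets of the theorem have this form, for re the real part. *)
Definition parameter (l : K) : Prop := -1 <= re l < 1 \/ l = 1.

Let re_int (m : int) : re m%:~R = m%:~R.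
Proof. by rewrite -[_%:~R]add0r reD re0 add0r. Qed.

(** Induction on a bound for |re l|, moving by 2 towards the strip. The excluded moves start at -1
    or 1, which are already parameters. *)
Lemma parameter_reach (S : K -> Prop) :
  (forall l, S l -> l != -1 -> S (l + 2)) ->
  (forall l, S l -> l != 1 -> S (l - 2)) ->
  forall l, S l -> exists l', parameter l' /\ S l'.
Proof.
move=> up down l; have re2 x : re (x + 2) = re x + 2 by exact: (reD x 2).
have reN2 x : re (x - 2) = re x - 2 by exact: (reD x (-2)).
have reN1 : re (-1) = -1 by exact: (re_int (-1)).
have [n] : exists n, `|re l| <= n.+1%:R.
  exists (Num.bound `|re l|); apply/ltW/(lt_trans (archi_boundP (normr_ge0 _))).
  by rewrite ltr_nat.
elim: n l => [|n IHn] l; rewrite ler_norml => /andP[ge le] Sl.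
  have [l1|l1] := ltrP (re l) 1.
    by exists l; split=> //; left; rewrite ge.
  have [l1'|l1'] := eqVneq l 1; first by exists l; split=> //; right.
  (* Here re l = 1 but l is not 1; the move lands on the line re = -1, which belongs to the
     strip. *)
  by exists (l - 2); split; [left; rewrite reN2; lra|apply: down].
have [ltN1|geN1] := ltrP (re l) (-1).
  apply: (IHn (l + 2)); last first.
    by apply: up => //; apply: contraTneq ltN1 => ->; rewrite reN1 ltxx.
  rewrite re2 ler_norml; move: ge le; rewrite -natr1 -[n.+1%:R]natr1.
  have : 0 <= n%:R :> R by [].
  by move=> ? ? ?; apply/andP; split; lra.
have [l1|l1] := ltrP (re l) 1.
  by exists l; split=> //; left; rewrite geN1.
have [l1'|l1'] := eqVneq l 1; first by exists l; split=> //; right.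
apply: (IHn (l - 2)); last exact: down.
rewrite reN2 ler_norml; move: ge le; rewrite -natr1 -[n.+1%:R]natr1.
have : 0 <= n%:R :> R by [].
by move=> ? ? ?; apply/andP; split; lra.
Qed.

Lemma parameter_odd l : parameter l -> odd_integer l -> l = 1 \/ l = -1.
Proof.
move=> lP /odd_integerP[m om lE]; case: lP => [|->]; last by left.
rewrite lE re_int => mP.
have {}mP : (-1 <= m < 1)%R by rewrite -(ler_int R) -(ltr_int R).
by right; have -> : m = -1 by lia.
Qed.

Lemma parameter_index_range l : parameter l -> index_range l 1.
Proof.
move=> lP; have [lo|lN] := boolP (odd_integer l).
  by case: (parameter_odd lP lo) => ->; rewrite ?index_range1 ?index_rangeN1.
by rewrite /index_range lN.
Qed.

(** The difference l - l' is the even integer k - 1, and the strip is half-open of width 2. Only the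
    pair 1, -1 could differ; then k is -1 for l' = 1 or 3 for l' = -1, outside the index range
    either way. *)
Lemma parameter_unique (l l' : K) k : parameter l -> parameter l' ->
  index_range l' k -> odd `|k|%N -> l = l' - 1 + k%:~R -> l = l'.
Proof.
move=> lP l'P kr ko lE.
have {}lE : l = l' + (k - 1)%:~R by rewrite lE intrB; ring.
have rE : re l = re l' + (k - 1)%:~R by rewrite lE reD.
have re1 : re 1 = 1 by exact: (re_int 1).
have [k1|kN1] := eqVneq k 1; first by rewrite lE k1 subrr addr0.
have kcase : k - 1 <= -2 \/ 2 <= k - 1 by lia.
have {kcase} kcase :
  (k - 1)%:~R <= (-2)%:~R :> R \/ 2%:~R <= (k - 1)%:~R :> R by rewrite !ler_int.
case: lP l'P => [/andP[a b]|l1] [/andP[a' b']|l1'].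
- by case: kcase => ?; exfalso; clear lE; lra.
- have kE : k = -1.
    have : ((-2)%:~R <= (k - 1)%:~R :> R) && ((k - 1)%:~R < 0%:~R :> R).
      by move: rE; rewrite l1' re1 => rE; clear lE l1'; apply/andP; split; lra.
    by rewrite ler_int ltr_int; lia.
  by move: kr; rewrite l1' kE index_range1.
- have kE : k = 3.
    have : (0%:~R < (k - 1)%:~R :> R) && ((k - 1)%:~R <= 2%:~R :> R).
      by move: rE; rewrite l1 re1 => rE; clear lE l1; apply/andP; split; lra.
    by rewrite ler_int ltr_int; lia.
  have l'E : l' = -1 by apply: (addIr (k - 1)%:~R); rewrite -lE l1 kE; ring.
  by move: kr; rewrite l'E kE index_rangeN1.
- by rewrite l1 l1'.
Qed.

Lemma exists_unique_parameter (P : set K) (V : asl2_rep K) :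
  (forall l, P l <-> parameter l) ->
  infinite_dimensional V -> irreducible V -> weighted V ->
  exists! l, P l /\ isomorphic V (Vrep l).
Proof.
move=> PE Vinf Virr Vwt; have [m mw] := exists_weight Vinf Virr Vwt.
have [l [lP lw]] :=
  parameter_reach (@has_weight_up _ V) (@has_weight_down _ V) mw.
have lV : isomorphic V (Vrep l).
  have [lo|lN] := boolP (odd_integer l); last exact: isomorphic_nonodd.
  case: (parameter_odd lP lo) lw => ->; first exact: isomorphic_pos1.
  exact: isomorphic_neg1.
exists l; split=> [|l' [/PE l'P l'V]]; first by split=> //; apply/PE.
have [k [kr ko lE]] := isomorphic_weight (parameter_index_range lP) lV l'V.
exact: parameter_unique lE.
Qed.

End ParameterSet.

(** * Specialization to the real and complex fields *)

Theorem theorem3 (R : realType) :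
  (forall V : asl2_rep R,
     infinite_dimensional V -> irreducible V -> weighted V ->
     exists! l : R, real_parameters l /\ isomorphic V (Vrep l)) /\
  (forall V : asl2_rep R[i],
     infinite_dimensional V -> irreducible V -> weighted V ->
     exists! l : R[i], complex_parameters l /\ isomorphic V (Vrep l)).
Proof.
split=> V; [apply: (@exists_unique_parameter R R id)|
  apply: (@exists_unique_parameter R R[i] (@complex.Re R))].
- by [].
- by [].
- move=> l; rewrite /parameter /real_parameters /=; split=> [/andP[a b]|].
    by have [b'|b'] := ltrP l 1; [left; rewrite a|right; lra].
  by case=> [|->]; lra.
- by [].
- move=> [a b] m; rewrite -(rmorph_int (real_complex R)) /=; simpc. by [].
(* Real points of [-1, 1) already lie in the strip, so the segment adds only the point 1. *)
- move=> l; rewrite /parameter /complex_parameters /=; split.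
    case=> [[r /andP[a b] ->]|]; last by left.
    by have [b'|b'] := ltrP r 1; [left; rewrite /= a|
      right; congr (_%:C)%C; lra].
  case=> [|->]; first by right.
  by left; exists 1; rewrite ?lexx // andbT; lra.
Qed.
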